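(* Let $R$ be a Noetherian ring. Then the following statements are equivalent: (a) $R$ is a left cu-uniserial ring. (b) $R$ is either a left uniserial ring of finite length, or a principal left ideal domain with $\mathrm{J}(R)=0$, or a local principal left ideal domain. (c) $R$ is either a left uniserial ring or a principal left ideal domain with $\mathrm{J}(R)=0$. (d) $R$ is either a left uniserial ring or a principal ideal domain with $\mathrm{J}(R)=0$.
   Context: All rings are associative with identity and all modules are unitary left modules. A ring is Noetherian if it is both left and right Noetherian. A principal left ideal domain is a (not necessarily commutative) domain in which every left ideal is principal; a principal ideal domain is a domain in which every left ideal and every right ideal is principal. A ring is local if it has a unique maximal left ideal. $\mathrm{J}(R)$ is the Jacobson radical. For a module $K$, $\mathrm{Rad}(K)$ denotes the intersection of all maximal submodules of $K$ (equal to $K$ if there are none). A nonzero module is uniform if every nonzero submodule is essential. A left $R$-module $M$ is cyclic-uniform uniserial (cu-uniserial) if for every finitely generated submodule $0\neq K\subseteq M$, $K/\mathrm{Rad}(K)$ is cyclic and uniform. A module is uniserial if its submodules are linearly ordered by inclusion. The ring $R$ is left cu-uniserial (resp. left uniserial) if the left module ${}_RR$ is cu-uniserial (resp. uniserial); a left uniserial ring of finite length is one for which ${}_RR$ has a composition series. *)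

(* Defs.v *)
From HB Require Import structures.
From mathcomp Require Import all_boot all_algebra.
From mathcomp Require Import boolp.

Set Implicit Arguments.
Unset Strict Implicit.
Unset Printing Implicit Defensive.

Import GRing.Theory.
Local Open Scope ring_scope.
Local Open Scope quotient_scope.

(** Conventions.
    - A ring is a [pzRingType]: associative, unital, not necessarily
      commutative, and possibly zero.  A left R-module is an [lmodType R].
    - A submodule of M is a term of MathComp's bundled type [submodClosed M],
      that is, a predicate [M -> bool] closed under the module operations.
      There is no loss of generality in the codomain [bool]: by [boolp.asbool]
      every Prop-valued predicate is of this form.
    - Left ideals of R are the submodules of the regular module [R^o]; right
      ideals of R are the submodules of [(R^c)^o], with [R^c] the opposite
      ring, whose left modules are the right R-modules. *)

Section Submodule.
Variables (R : pzRingType) (M : lmodType R) (N : submodClosed M).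

Record submod : Type := Submod { submod_val : M; _ : submod_val \in N }.

HB.instance Definition _ := [isSub for submod_val].
HB.instance Definition _ := [Choice of submod by <:].
HB.instance Definition _ := [SubChoice_isSubLmodule of submod by <:].

End Submodule.

Section QuotientModule.
Variables (R : pzRingType) (M : lmodType R) (N : submodClosed M).

(* A [submodClosed] predicate is not canonically a [zmodClosed] one, because
   [submodClosed] also makes sense over semirings; hence this copy of [N]. *)
Definition submod_zpred : M -> bool := fun x => x \in N.

HB.instance Definition _ :=
  GRing.isZmodClosed.Build M submod_zpred (GRing.submod_closedB (submodClosedP N)).

Definition submod_zmod : zmodClosed M := GRing.ZmodClosed.clone M submod_zpred _.

Definition quotmod : Type := Quotient.quot submod_zmod.
HB.instance Definition _ := GRing.Zmodule.on quotmod.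

Definition quot_proj (x : M) : quotmod := \pi_(Quotient.quot submod_zmod) x.

Definition quot_repr (u : quotmod) : M := repr (u : Quotient.quot submod_zmod).

Definition quot_scale (a : R) (u : quotmod) : quotmod :=
  quot_proj (a *: quot_repr u).

Fact quot_projP x y : reflect (quot_proj x = quot_proj y) (x - y \in N).
Proof.
by rewrite -[_ \in N]/(x - y \in submod_zmod) Quotient.idealrBE; exact: eqP.
Qed.

Fact quot_reprK : cancel quot_repr quot_proj.
Proof. by move=> u; exact: reprK. Qed.

Fact quot_projD : {morph quot_proj : x y / x + y}.
Proof. exact: (raddfD \pi_(Quotient.quot submod_zmod)). Qed.

Fact quot_scale_proj a x : quot_scale a (quot_proj x) = quot_proj (a *: x).
Proof.
apply/quot_projP; rewrite -scalerBr rpredZ //.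
by apply/quot_projP; rewrite quot_reprK.
Qed.

Fact quot_scaleA a b u : quot_scale a (quot_scale b u) = quot_scale (a * b) u.
Proof. by rewrite -(quot_reprK u) !quot_scale_proj scalerA. Qed.

Fact quot_scale1 : left_id 1 quot_scale.
Proof. by move=> u; rewrite -(quot_reprK u) quot_scale_proj scale1r. Qed.

Fact quot_scaleDr : right_distributive quot_scale +%R.
Proof.
move=> a u v; rewrite -(quot_reprK u) -(quot_reprK v).
by rewrite -quot_projD !quot_scale_proj scalerDr quot_projD.
Qed.

Fact quot_scaleDl u : {morph quot_scale^~ u : a b / a + b}.
Proof.
move=> a b /=; rewrite -(quot_reprK u).
by rewrite !quot_scale_proj scalerDl quot_projD.
Qed.

HB.instance Definition _ := GRing.Zmodule_isLmodule.Build R quotmod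
  quot_scaleA quot_scale1 quot_scaleDr quot_scaleDl.

Fact quot_proj_is_linear : linear quot_proj.
Proof. by move=> a x y; rewrite quot_projD -quot_scale_proj. Qed.

HB.instance Definition _ :=
  GRing.isLinear.Build R M quotmod *:%R quot_proj quot_proj_is_linear.

End QuotientModule.

Section Restriction.
Variables (R : pzRingType) (M : lmodType R) (N K : submodClosed M).

Definition restr_pred : submod K -> bool := fun x => val x \in N.

Fact restr_submod_closed : submod_closed restr_pred.
Proof.
have restrE x : (x \in restr_pred) = (val x \in N) by [].
by split=> [|a x y]; rewrite !restrE ?rpred0 // => Nx Ny; rewrite rpredD ?rpredZ.
Qed.

HB.instance Definition _ :=
  GRing.isSubmodClosed.Build R (submod K) restr_pred restr_submod_closed.

(* The intersection of [N] and [K], as a submodule of [K]. *)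
Definition restr : submodClosed (submod K) :=
  GRing.SubmodClosed.clone R (submod K) restr_pred _.

End Restriction.

Section Radical.
Variables (R : pzRingType) (M : lmodType R).
Implicit Types N K : submodClosed M.

Definition zero_submod N := forall x, x \in N -> x = 0.
Definition full_submod N := forall x, x \in N.

Definition maximal_submod N :=
  ~ full_submod N /\
  forall K, {subset N <= K} -> {subset K <= N} \/ full_submod K.

Definition rad_pred : M -> bool :=
  fun x => `[< forall N, maximal_submod N -> x \in N >].

Fact rad_submod_closed : submod_closed rad_pred.
Proof.
split=> [|a x y]; first by apply/asboolP => N _; rewrite rpred0.
move=> /asboolP radx /asboolP rady; apply/asboolP => N maxN.
by rewrite rpredD ?rpredZ ?radx ?rady.
Qed.

HB.instance Definition _ :=
  GRing.isSubmodClosed.Build R M rad_pred rad_submod_closed.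

Definition Rad : submodClosed M := GRing.SubmodClosed.clone R M rad_pred _.

End Radical.

Arguments Rad {R} M.

Section ModuleProperties.
Variables (R : pzRingType) (M : lmodType R).
Implicit Types N L : submodClosed M.

Definition nonzero_module := exists x : M, x != 0.

Definition finitely_generated :=
  exists n (g : 'I_n -> M), forall x, exists a : 'I_n -> R,
    x = \sum_(i < n) a i *: g i.

Definition cyclic_module := exists g : M, forall x, exists a : R, x = a *: g.

Definition essential N :=
  forall L, ~ zero_submod L -> exists x, [/\ x \in N, x \in L & x != 0].

Definition uniform_module :=
  nonzero_module /\ forall N, ~ zero_submod N -> essential N.

Definition simple_module :=
  nonzero_module /\ forall N, zero_submod N \/ full_submod N.

Definition uniserial := forall N L, {subset N <= L} \/ {subset L <= N}.

Definition noetherian_module :=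
  forall N : nat -> submodClosed M,
    (forall i, {subset N i <= N i.+1}) ->
  exists n, forall m, (n <= m)%N -> {subset N m <= N n}.

End ModuleProperties.

Section CuUniserial.
Variables (R : pzRingType) (M : lmodType R).

(* Existence of a composition series; [N i] is irrelevant for [i > n]. *)
Definition finite_length :=
  exists n (N : nat -> submodClosed M),
    [/\ zero_submod (N 0%N), full_submod (N n)
      & forall i, (i < n)%N ->
          {subset N i <= N i.+1} /\
          simple_module (quotmod (restr (N i) (N i.+1)))].

Definition cu_uniserial :=
  forall K : submodClosed M,
    finitely_generated (submod K) -> ~ zero_submod K ->
    cyclic_module (quotmod (Rad (submod K))) /\
    uniform_module (quotmod (Rad (submod K))).

End CuUniserial.

Section RingProperties.
Variable R : pzRingType.

Definition noetherian_ring :=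
  noetherian_module R^o /\ noetherian_module (R^c)^o.

Definition left_uniserial_ring := uniserial R^o.

Definition left_cu_uniserial_ring := cu_uniserial R^o.

Definition left_finite_length := finite_length R^o.

(* [GRing.integral_domain_axiom] does not assume commutativity. *)
Definition domain := (1 : R) != 0 /\ GRing.integral_domain_axiom R.

Definition left_ideals_principal :=
  forall I : submodClosed R^o,
    exists a : R, forall x : R, x \in I <-> exists r, x = r * a.

Definition right_ideals_principal :=
  forall I : submodClosed (R^c)^o,
    exists a : R, forall x : R, x \in I <-> exists r, x = a * r.

Definition principal_left_ideal_domain := domain /\ left_ideals_principal.

Definition principal_ideal_domain :=
  [/\ domain, left_ideals_principal & right_ideals_principal].

Definition jacobson_radical : submodClosed R^o := Rad R^o.

Definition local_ring :=
  exists I : submodClosed R^o, maximal_submod I /\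
    forall I' : submodClosed R^o, maximal_submod I' -> I' =i I.

End RingProperties.

(* Main.v *)
From HB Require Import structures.
Require Import Defs.
From mathcomp Require Import all_boot all_algebra.
From mathcomp Require Import boolp.

Set Implicit Arguments.
Unset Strict Implicit.
Unset Printing Implicit Defensive.

Import GRing.Theory.
Local Open Scope ring_scope.

(** Why the theorem is true.  Write J for the Jacobson radical of R.

    If R is left cu-uniserial, Nakayama's lemma makes every left ideal K
    principal, since K / Rad K is cyclic and K is finitely generated
    ([cu_uniserial_principal]); and K = R gives that R / J is a uniform left
    module.  A semiprimitive, left Noetherian, left uniform ring is a domain, so
    J is completely prime ([uniform_jacobson_prime]).

    Suppose that J = Rp is neither 0 nor R.  If w is not in J, then Rw contains
    J and right multiplication by w is a bijection of J ([jacobson_right_mul],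
    [surj_right_mul_inj]).  Hence p = tpz with t in R, for each z not in J.  The
    chain of right ideals t^n pR is then ascending, so that t^n p (1 - sz) = 0
    for some n and s ([right_fixpoint]); as t^n p lies in J and is not 0, this
    puts 1 - sz in J, and z is left invertible.  So R is local as soon as J is
    not 0 ([prime_jacobson_dichotomy]).  If J = 0, then R is a domain.

    In a local ring with principal left ideals any two left ideals are
    comparable: were a and b both in Jc, where Rc = Ra + Rb, then c would lie
    in Jc and vanish ([local_uniserial]).  If p is nilpotent, the powers Rp^n
    form a composition series.  Otherwise the intersection I of all Rp^n satisfies
    I = Ip, so I = 0 by [right_fixpoint] again; then every nonzero element is a
    unit times a power of p, and R is a domain ([local_principal_dichotomy]).
    This proves that (a) implies (b), and (b) implies (c) by [local_uniserial].

    For (c) implies (d), a right Noetherian domain is a right Ore domain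
    ([noetherian_ore]), and in a right Ore domain the left Bezout property
    yields the right one ([right_bezout]).

    For (d) implies (a), a nonzero left ideal of a principal left ideal domain
    with J = 0 is isomorphic to R, and is uniform by the left Ore condition
    ([semiprimitive_pli_domain_cu_uniserial]).  In a Noetherian left uniserial
    ring the nonzero left ideals are cyclic, and their quotients are uniserial,
    hence uniform when nonzero ([uniserial_cu_uniserial]). *)

(** * Submodules given by propositional predicates *)

Section PropSubmodules.
Variables (R : pzRingType) (M : lmodType R).
Implicit Types (P : M -> Prop) (N : submodClosed M).

Definition submod_prop P := P 0 /\ forall a x y, P x -> P y -> P (a *: x + y).

(** The closure proof is a phantom argument: it lets the submodule structure be
    attached to the predicate canonically. *)
Definition prop_pred P of submod_prop P : M -> bool := fun x => `[<P x>].

Fact prop_pred_closed P (PP : submod_prop P) : submod_closed (prop_pred PP).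
Proof.
split=> [|a x y]; first by apply/asboolP; case: PP.
by move=> /asboolP Px /asboolP Py; apply/asboolP; case: PP => _; apply.
Qed.

HB.instance Definition _ P (PP : submod_prop P) :=
  GRing.isSubmodClosed.Build R M (prop_pred PP) (prop_pred_closed PP).

Definition mk_submod P (PP : submod_prop P) : submodClosed M :=
  GRing.SubmodClosed.clone R M (prop_pred PP) _.

Lemma mk_submodP P (PP : submod_prop P) x : x \in mk_submod PP <-> P x.
Proof. by split=> /asboolP. Qed.

Lemma submodZD N a x y : x \in N -> y \in N -> a *: x + y \in N.
Proof. by move=> Nx Ny; rewrite rpredD // rpredZ. Qed.

(** The sum of N and the cyclic submodule generated by x. *)
Definition adjoin_prop N x (y : M) := exists a, y - a *: x \in N.

Lemma adjoin_propP N x : submod_prop (adjoin_prop N x).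
Proof.
split=> [|b y z [a Ny] [c Nz]]; first by exists 0; rewrite scale0r subr0 rpred0.
exists (b * a + c); rewrite scalerDl -scalerA opprD addrACA -scalerBr.
exact: submodZD.
Qed.

Definition adjoin N x := mk_submod (adjoin_propP N x).

Lemma adjoinP N x y : y \in adjoin N x <-> exists a, y - a *: x \in N.
Proof. exact: mk_submodP. Qed.

Lemma sub_adjoin N x : {subset N <= adjoin N x}.
Proof. by move=> y Ny; apply/adjoinP; exists 0; rewrite scale0r subr0. Qed.

Lemma mem_adjoin N x : x \in adjoin N x.
Proof. by apply/adjoinP; exists 1; rewrite scale1r subrr rpred0. Qed.

Lemma cyclic_prop x : submod_prop (fun y => exists a, y = a *: x).
Proof.
split=> [|b _ _ [a ->] [c ->]]; first by exists 0; rewrite scale0r.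
by exists (b * a + c); rewrite scalerDl scalerA.
Qed.

Definition cyclic_submod x := mk_submod (cyclic_prop x).

Lemma cyclic_submodP x y : y \in cyclic_submod x <-> exists a, y = a *: x.
Proof. exact: mk_submodP. Qed.

Lemma mem_cyclic_submod x : x \in cyclic_submod x.
Proof. by apply/cyclic_submodP; exists 1; rewrite scale1r. Qed.

Lemma nonzero_submodP N : ~ zero_submod N -> exists2 x, x \in N & x != 0.
Proof.
move=> nzN; apply: contrapT => noN; apply: nzN => x Nx.
by apply: contrapT => /eqP x0; apply: noN; exists x.
Qed.

End PropSubmodules.

(** * Chain conditions *)

Section Noetherian.
Variables (R : pzRingType) (M : lmodType R).
Hypothesis noethM : noetherian_module M.
Implicit Types N K : submodClosed M.

Lemma noetherian_chain (P : nat -> M -> Prop) :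
    (forall n, submod_prop (P n)) -> (forall n x, P n x -> P n.+1 x) ->
  exists n, forall x, P n.+1 x -> P n x.
Proof.
move=> PP incP; have [|n stab] := noethM (N := fun n => mk_submod (PP n)).
  by move=> n x /mk_submodP/incP Px; apply/mk_submodP.
exists n => x Px; apply/(mk_submodP (PP n))/(stab n.+1) => //.
exact/mk_submodP.
Qed.

(** If no such N existed, every admissible submodule would have a strictly
    larger admissible one, and dependent choice would produce an infinite
    strictly ascending chain. *)
Lemma noetherian_maximal (P : submodClosed M -> Prop) N0 : P N0 ->
  exists N, [/\ P N, {subset N0 <= N}
              & forall K, P K -> {subset N <= K} -> {subset K <= N}].
Proof.
move=> PN0; apply: contrapT => noN.
pose T := {N | P N /\ {subset N0 <= N}}.
have step (N : T) :
    exists K : T, {subset sval N <= sval K} /\ ~ {subset sval K <= sval N}.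
  case: N => N [PN sN] /=; apply: contrapT => noK; apply: noN; exists N.
  split=> // K PK sNK; apply: contrapT => nKN; apply: noK.
  by exists (exist _ K (conj PK (fun x Nx => sNK x (sN x Nx)))).
have [f fP] := choice step.
pose N0T : T := exist _ N0 (conj PN0 (fun x (Nx : x \in N0) => Nx)).
have [n stab] := noethM (N := fun n => sval (iter n f N0T))
                        (fun n => (fP (iter n f N0T)).1).
exact: (fP (iter n f N0T)).2 (stab n.+1 (leqnSn n)).
Qed.

Lemma noetherian_sub_maximal N : ~ full_submod N ->
  exists2 K, maximal_submod K & {subset N <= K}.
Proof.
move=> /(noetherian_maximal (P := fun K => ~ full_submod K)) [K [pK sK maxK]].
exists K => //; split=> // L sL.
case: (pselect (full_submod L)); first by right.
by left; apply: maxK.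
Qed.

(** A chain of submodules of K is also a chain of submodules of M, via its
    images under the inclusion. *)
Lemma noetherian_submod K : noetherian_module (submod K).
Proof.
move=> N incN.
have imP n : submod_prop (fun x => exists2 k, k \in N n & \val k = x :> M).
  split=> [|a x y [k Nk <-] [l Nl <-]]; first by exists 0; rewrite ?rpred0.
  by exists (a *: k + l) => //; apply: submodZD.
have [|n stab] := noethM (N := fun n => mk_submod (imP n)).
  by move=> n x /mk_submodP[k /incN Nk <-]; apply/mk_submodP; exists k.
exists n => m /stab sub k Nk.
have /sub/mk_submodP[l Nl /val_inj <- //] : val k \in mk_submod (imP m).
by apply/mk_submodP; exists k.
Qed.

(** A maximal finitely generated submodule must be the whole module, because
    adjoining any element to it keeps it finitely generated. *)
Lemma noetherian_fg : finitely_generated M.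
Proof.
pose fg N := exists n (g : 'I_n -> M),
  forall x, x \in N <-> exists a : 'I_n -> R, x = \sum_(i < n) a i *: g i.
have fg0 : fg (cyclic_submod 0).
  exists 0%N, (fun=> 0) => x; split.
    by case/cyclic_submodP=> a ->; exists (fun=> 0); rewrite big_ord0 scaler0.
  by case=> a ->; rewrite big_ord0 rpred0.
have [N [[n [g gP]] _ maxN]] := noetherian_maximal fg0.
exists n, g => x; apply/gP; apply: (maxN (adjoin N x)).
- exists n.+1, (fun i => oapp g x (unlift ord0 i)) => y; split.
    case/adjoinP=> a /gP[b yE].
    exists (fun i => oapp b a (unlift ord0 i)).
    rewrite big_ord_recl unlift_none /=.
    under eq_bigr do rewrite liftK /=.
    by rewrite -yE addrC subrK.
  case=> a ->; apply/adjoinP; exists (a ord0).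
  rewrite big_ord_recl unlift_none /= [_ + \sum_(_ < _) _]addrC addrK.
  apply/gP; exists (fun i => a (lift ord0 i)).
  by apply: eq_bigr => i _; rewrite liftK.
- exact: sub_adjoin.
- exact: mem_adjoin.
Qed.

End Noetherian.

(** * The radical *)

Section Rad.
Variables (R : pzRingType) (M : lmodType R).
Implicit Types N K : submodClosed M.

Lemma RadP (x : M) :
  x \in Rad M <-> forall N : submodClosed M, maximal_submod N -> x \in N.
Proof. by split=> /asboolP. Qed.

Lemma maximal_submod_gen N x y : maximal_submod N -> x \notin N ->
  exists a, y - a *: x \in N.
Proof.
move=> [_ maxN] Nx; apply/adjoinP.
have [sub | full] := maxN _ (@sub_adjoin _ _ N x); last exact: full.
by rewrite sub // mem_adjoin in Nx.
Qed.

(** Nakayama's lemma: if a lift g of a generator of M / Rad M did not generate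
    M, then g would lie in some maximal submodule, and so would all of
    Rg + Rad M = M. *)
Lemma noetherian_cyclic : noetherian_module M ->
  cyclic_module (quotmod (Rad M)) -> cyclic_module M.
Proof.
move=> noethM [u uP]; rewrite -[u]quot_reprK in uP; set g := quot_repr u in uP.
suff full : full_submod (cyclic_submod g).
  by exists g => x; apply/cyclic_submodP/full.
apply: contrapT => /(noetherian_sub_maximal noethM) [N maxN sN].
case: (maxN) => nfull _; apply: nfull => x.
have [a] := uP (quot_proj (Rad M) x).
rewrite -linearZ /= => /quot_projP /RadP /(_ N maxN) Nx.
by rewrite -(subrK (a *: g) x) rpredD // rpredZ // sN // mem_cyclic_submod.
Qed.

Lemma quot_proj_neq0 N x : (quot_proj N x != 0) = (x \notin N).
Proof.
rewrite -(linear0 (quot_proj N)).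
congr negb; apply/eqP/idP => [/quot_projP|Nx]; first by rewrite subr0.
by apply/quot_projP; rewrite subr0.
Qed.

(** Uniformity only needs to be tested on cyclic submodules: two elements
    outside N must have a common multiple that is nonzero modulo N. *)
Lemma uniform_quotP N : uniform_module (quotmod N) <->
  ~ full_submod N /\ forall x y, x \notin N -> y \notin N ->
    exists a b, a *: x \notin N /\ a *: x - b *: y \in N.
Proof.
split=> [[[u u0] unif] | [nfull unif]].
  split=> [full|x y Nx Ny].
    by move: u0; rewrite -[u]quot_reprK quot_proj_neq0 full.
  have nz z : z \notin N -> ~ zero_submod (cyclic_submod (quot_proj N z)).
    rewrite -quot_proj_neq0 => /negP Nz /(_ _ (mem_cyclic_submod _)).
    by move/eqP.
  have [w [/cyclic_submodP[a wa] /cyclic_submodP[b wb] w0]] :=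
    unif _ (nz x Nx) _ (nz y Ny).
  exists a, b; rewrite -quot_proj_neq0 linearZ /= -wa; split=> //.
  by apply/quot_projP; rewrite !linearZ /= -wa.
have [x0 Nx0] : exists x, x \notin N.
  apply: contrapT => noN; apply: nfull => x.
  by apply: contrapT => /negP Nx; apply: noN; exists x.
split; first by exists (quot_proj N x0); rewrite quot_proj_neq0.
move=> A /nonzero_submodP[u Au u0] B /nonzero_submodP[v Bv v0].
rewrite -[u]quot_reprK quot_proj_neq0 in u0.
rewrite -[v]quot_reprK quot_proj_neq0 in v0.
have [a [b [Nau /quot_projP abE]]] := unif _ _ u0 v0.
exists (a *: u); split; first by rewrite rpredZ.
  by move: abE; rewrite !linearZ /= !quot_reprK => ->; rewrite rpredZ.
by rewrite -[u]quot_reprK -linearZ /= quot_proj_neq0.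
Qed.

End Rad.

(** Preimages of maximal submodules under a surjection are maximal. *)
Lemma Rad_surj (R : pzRingType) (M M' : lmodType R) (f : {linear M -> M'}) x :
  (forall y, exists x, y = f x) -> x \in Rad M -> f x \in Rad M'.
Proof.
move=> surj /RadP radx; apply/RadP => N [nfull maxN].
have preP (L : submodClosed M') : submod_prop (fun z => f z \in L).
  split=> [|a y z Ly Lz]; first by rewrite linear0 rpred0.
  by rewrite linearP submodZD.
apply/(mk_submodP (preP N))/radx; split=> [full|K sK].
  by apply: nfull => y; have [z ->] := surj y; apply/(mk_submodP (preP N)).
have imP : submod_prop (fun y => exists2 z, z \in K & f z = y).
  split=> [|a y z [k Kk <-] [l Kl <-]].
    by exists 0; rewrite ?rpred0 ?linear0.
  by exists (a *: k + l); rewrite ?linearP ?submodZD.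
have [|sub|full] := maxN (mk_submod imP).
- move=> y Ny; have [z yE] := surj y; apply/mk_submodP; exists z => //.
  by apply/sK/mk_submodP; rewrite -yE.
- left=> z Kz; apply/mk_submodP/sub/mk_submodP; by exists z.
right=> z; have /mk_submodP[k Kk fkz] := full (f z).
rewrite -(subrK k z) rpredD // sK //; apply/mk_submodP.
by rewrite linearB fkz subrr rpred0.
Qed.

Lemma Rad_iso (R : pzRingType) (M M' : lmodType R) (f : {linear M -> M'}) x :
  injective f -> (forall y, exists x, y = f x) ->
  (x \in Rad M) = (f x \in Rad M').
Proof.
move=> injf surj; apply/idP/idP; first exact: Rad_surj.
have [g gP] := choice surj.
have fK : cancel f g by move=> z; apply: injf; rewrite -gP.
have gK : cancel g f by move=> z; rewrite -gP.
pose gL := GRing.isLinear.Build R M' M *:%R g (GRing.can2_linear fK gK).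
pose g' : {linear M' -> M} := HB.pack g gL.
rewrite -{2}(fK x); apply: (@Rad_surj R M' M g') => z.
by exists (f z); rewrite /= fK.
Qed.

(** * Ideals and the Jacobson radical *)

Section LeftIdeals.
Variable R : pzRingType.
Implicit Types (x y z : R) (I : submodClosed R^o).

Lemma ideal_mull I r x : x \in I -> r * x \in I.
Proof.
move=> Ix; have := submodZD r (Ix : (x : R^o) \in I) (rpred0 I).
by rewrite addr0.
Qed.

Lemma ideal0 I : (0 : R) \in I.
Proof. exact: rpred0. Qed.

Lemma ideal_addr I x y : x \in I -> y \in I -> x + y \in I.
Proof. exact: rpredD. Qed.

Lemma ideal_full I : 1 \in I -> full_submod I.
Proof. by move=> I1 x; rewrite -[x]mulr1; apply: ideal_mull. Qed.

Lemma ideal_subl1 I x : 1 \notin I -> x \in I -> 1 - x \notin I.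
Proof.
by move=> I1 Ix; apply: contra I1 => /ideal_addr/(_ Ix); rewrite subrK.
Qed.

Hypothesis noethR : noetherian_module R^o.

Local Notation J := (jacobson_radical R).

(** A left ideal R (1 - rx) is proper exactly when it sits in a maximal left
    ideal, and such an ideal cannot contain x. *)
Lemma jacobsonP x : x \in J <-> forall r, exists s, s * (1 - r * x) = 1.
Proof.
split=> [/RadP Jx r | linv].
  have [full|] := pselect (full_submod (cyclic_submod (1 - r * x : R^o))).
    by have /cyclic_submodP[s sE] := full (1 : R); exists s.
  move=> /(noetherian_sub_maximal noethR)[N maxN sN].
  case: (maxN) => nfull _; case: nfull; apply: ideal_full.
  rewrite -(subrK (r * x) 1); apply: ideal_addr; last exact/ideal_mull/Jx.
  exact/sN/mem_cyclic_submod.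
apply/RadP => N maxN; apply: contrapT => /negP Nx.
have [r Nr] := @maximal_submod_gen R R^o N x 1 maxN Nx.
have [s s1] := linv r.
case: (maxN) => nfull _; apply/nfull/ideal_full.
by rewrite -s1; apply: ideal_mull.
Qed.

(** J is a two-sided ideal: if s is a left inverse of 1 - ry, then 1 + ysr is a
    left inverse of 1 - yr. *)
Lemma jacobson_mulr x r : x \in J -> x * r \in J.
Proof.
move=> Jx; apply/jacobsonP => t.
have /jacobsonP/(_ r)[s s1] : t * x \in J by apply: ideal_mull.
exists (1 + t * x * s * r).
have -> : t * (x * r) = t * x * r by rewrite mulrA.
move: (t * x) s1 => y s1.
have e : s * (r * (1 - y * r)) = r.
  have -> : r * (1 - y * r) = (1 - r * y) * r.
    by rewrite mulrBr mulrBl mulr1 mul1r mulrA.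
  by rewrite mulrA s1 mul1r.
by rewrite mulrDl mul1r -!mulrA e subrK.
Qed.

(** The left inverse s of 1 - x equals 1 + sx, which is again left invertible
    because x is in J; so s is a unit. *)
Lemma jacobson_unit x : x \in J -> exists s, s * (1 - x) = 1 /\ (1 - x) * s = 1.
Proof.
move=> Jx; have /jacobsonP/(_ 1) := Jx; rewrite mul1r => -[s s1].
have /jacobsonP/(_ (- s))[t] := Jx.
rewrite mulNr opprK.
have -> : 1 + s * x = s by rewrite -{1}s1 mulrBr mulr1 subrK.
move=> t1; exists s; split=> //.
have -> : 1 - x = t by rewrite -[LHS]mul1r -{1}t1 -mulrA s1 mulr1.
exact: t1.
Qed.

(** 1 - x is a right factor of 1 - x^n. *)
Lemma exp_linv x n :
  (exists s, s * (1 - x ^+ n) = 1) -> exists s, s * (1 - x) = 1.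
Proof.
move=> [s s1]; exists (s * \sum_(i < n) x ^+ i); rewrite -mulrA -[RHS]s1.
congr (_ * _); apply: oppr_inj; rewrite -mulrN !opprB subrX1.
have cx : GRing.comm (x - 1) (\sum_(i < n) x ^+ i).
  apply: commr_sum => i _; apply/commr_sym/commrB; last exact: commr1.
  exact/commr_sym/commrX.
by rewrite -cx.
Qed.

Lemma exp_mulS x y n : (x * y) ^+ n.+1 = x * (y * x) ^+ n * y.
Proof.
elim: n => [|n IH]; first by rewrite expr1 expr0 mulr1.
by rewrite exprSr IH [in RHS]exprSr !mulrA.
Qed.

End LeftIdeals.

(** * Rings whose left ideals are principal *)

(** The right ideals r^n x R increase with n, because r^n x = r^(n+1) x z; so
    r^(n+1) x = r^n x s for some n and s.  When 1 - sz is cancellable on the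
    right this forces x = 0, which is a substitute for Nakayama's lemma over the
    right module generated by x. *)
Lemma right_fixpoint (R : pzRingType) (x r z : R) :
    noetherian_module (R^c)^o -> x = r * x * z ->
  exists n s, x = r ^+ n * x * z ^+ n /\ r ^+ n * x * (1 - s * z) = 0.
Proof.
move=> noeth xE.
have stepE n : r ^+ n * x = r ^+ n.+1 * x * z by rewrite exprSr {1}xE !mulrA.
have [| |n stab] := @noetherian_chain R^c (R^c)^o noeth
  (fun n (y : R) => exists s, y = r ^+ n * x * s).
- move=> n; split=> [|a _ _ [s ->] [t ->]]; first by exists 0; rewrite mulr0.
  exists (s * a + t); rewrite mulrDr mulrA; by [].
- by move=> n _ [s ->]; exists (z * s); rewrite stepE mulrA.
have [|s sE] := stab (r ^+ n.+1 * x); first by exists 1; rewrite mulr1.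
exists n, s; split.
  elim: n {stab sE} => [|n IH]; first by rewrite !expr0 mul1r mulr1.
  by rewrite {1}IH [r ^+ n * x]stepE [z ^+ n.+1]exprS !mulrA.
by rewrite mulrBr mulr1 {1}stepE sE !mulrA subrr.
Qed.

(** A surjective endomorphism of a Noetherian module is injective: the chain of
    the kernels of its iterates is stationary. *)
Lemma surj_right_mul_inj (R : pzRingType) (I : submodClosed R^o) (w : R) :
    noetherian_module R^o ->
    (forall x, x \in I -> exists2 y, y \in I & x = y * w) ->
  forall x, x \in I -> x * w = 0 -> x = 0.
Proof.
move=> noeth surj x Ix xw0.
have [| |n stab] := @noetherian_chain R R^o noeth
  (fun n (y : R) => y * w ^+ n = 0).
- move=> n; split=> [|a y z y0 z0]; first by rewrite mul0r.
  by rewrite mulrDl z0 -[a *: y]/(a * y) -mulrA y0 mulr0 addr0.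
- by move=> n y y0; rewrite exprSr mulrA y0 mul0r.
have [y Iy xE] : exists2 y, y \in I & x = y * w ^+ n.
  elim: n {stab} => [|n [y /surj[z Iz ->] xE]].
    by exists x; rewrite ?mulr1.
  by exists z => //; rewrite exprS mulrA.
by rewrite xE stab // exprSr mulrA -xE.
Qed.

Section PrincipalLeftIdeals.
Variable R : pzRingType.
Hypothesis princR : left_ideals_principal R.
Implicit Types (x y z a b c : R) (I : submodClosed R^o).

Lemma principal_prop (P : R -> Prop) : submod_prop (P : R^o -> Prop) ->
  exists a, forall x, P x <-> exists r, x = r * a.
Proof.
move=> PP; have [a aP] := princR (mk_submod PP).
exists a => x; rewrite -aP; exact: iff_sym (mk_submodP PP x).
Qed.

Lemma principal_pair a b :
  exists a' b' c u v, [/\ a = a' * c, b = b' * c & c = u * a + v * b].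
Proof.
have [|c cP] := @principal_prop (fun x => exists u v, x = u * a + v * b).
  split=> [|r _ _ [u [v ->]] [s [t ->]]].
    by exists 0, 0; rewrite !mul0r addr0.
  exists (r * u + s), (r * v + t).
  by rewrite -[r *: _]/(r * _) mulrDr !mulrDl !mulrA addrACA.
have [a' aE] : exists r, a = r * c.
  by apply/cP; exists 1, 0; rewrite mul1r mul0r addr0.
have [b' bE] : exists r, b = r * c.
  by apply/cP; exists 0, 1; rewrite mul1r mul0r add0r.
have [u [v cE]] : exists u v, c = u * a + v * b.
  by apply/cP; exists 1; rewrite mul1r.
by exists a', b', c, u, v.
Qed.

End PrincipalLeftIdeals.

(** The elementwise form of locality: such an I contains every proper left
    ideal. *)
Definition nonunit_ideal (R : pzRingType) (I : submodClosed R^o) :=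
  1 \notin I /\ forall z : R, z \notin I -> exists s, s * z = 1.

Lemma local_ringP (R : pzRingType) : noetherian_module R^o ->
  local_ring R <-> exists I : submodClosed R^o, nonunit_ideal I.
Proof.
move=> noeth; split=> [[I [maxI uniqI]] | [I [I1 invI]]].
  exists I; split.
    by case: maxI => nfull _; apply/negP => I1; apply/nfull/ideal_full.
  move=> z Iz; have [full|] := pselect (full_submod (cyclic_submod (z : R^o))).
    by have /cyclic_submodP[s sE] := full (1 : R); exists s.
  move=> /(noetherian_sub_maximal noeth)[N /uniqI NI sN].
  by move: Iz; rewrite -NI sN // mem_cyclic_submod.
have inI (K : submodClosed R^o) : ~ full_submod K -> {subset K <= I}.
  move=> nfull z Kz; apply: contrapT => /negP /invI[s s1].
  by apply/nfull/ideal_full; rewrite -s1; apply: ideal_mull.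
have nfullI : ~ full_submod I by move/(_ 1); apply/negP.
exists I; split.
  split=> // K _; case: (pselect (full_submod K)); first by right.
  by left; apply: inI.
move=> K [nfull maxK] z; apply/idP/idP; first exact: inI.
by case: (maxK I (inI K nfull)) => [|/nfullI //]; apply.
Qed.

Lemma comparable_uniserial (R : pzRingType) :
    (forall a b : R, (exists r, a = r * b) \/ (exists r, b = r * a)) ->
  left_uniserial_ring R.
Proof.
move=> comp N L; have [|nsub] := pselect {subset N <= L}; first by left.
right=> y Ly; apply: contrapT => Ny; apply: nsub => x Nx.
have [[r ->]|[r yE]] := comp x y; first exact: ideal_mull.
by case: Ny; rewrite yE; apply: ideal_mull.
Qed.

Lemma uniserial_comparable (R : pzRingType) : left_uniserial_ring R ->
  forall a b : R, (exists r, a = r * b) \/ (exists r, b = r * a).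
Proof.
move=> uni a b.
have [sub|sub] := uni (cyclic_submod (a : R^o)) (cyclic_submod (b : R^o)).
  by left; apply/(@cyclic_submodP R R^o)/sub/mem_cyclic_submod.
by right; apply/(@cyclic_submodP R R^o)/sub/mem_cyclic_submod.
Qed.

(** Let Rc = Ra + Rb with a = a'c and b = b'c.  If a' or b' is left invertible,
    then c is a multiple of a or of b.  Otherwise c = (ua' + vb')c with
    ua' + vb' in I, and c = 0. *)
Lemma local_uniserial (R : pzRingType) (I : submodClosed R^o) :
  left_ideals_principal R -> nonunit_ideal I -> left_uniserial_ring R.
Proof.
move=> princR [I1 invI]; apply: comparable_uniserial => a b.
have [a' [b' [c [u [v [aE bE cE]]]]]] := principal_pair princR a b.
have gen d d' s : d = d' * c -> s * d' = 1 -> forall e, exists r, e * c = r * d.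
  by move=> -> s1 e; exists (e * s); rewrite mulrA -[e * s * _]mulrA s1 mulr1.
have [Ia|/invI[s s1]] := boolP (a' \in I); last first.
  by right; rewrite {1}bE; apply: gen s1 _.
have [Ib|/invI[s s1]] := boolP (b' \in I); last first.
  by left; rewrite {1}aE; apply: gen s1 _.
have /(ideal_subl1 I1)/invI[s s1] : u * a' + v * b' \in I.
  by apply: ideal_addr; apply: ideal_mull.
have c0 : (1 - (u * a' + v * b')) * c = 0.
  by rewrite mulrBl mul1r mulrDl -!mulrA -aE -bE -cE subrr.
have {}c0 : c = 0 by rewrite -[c]mul1r -s1 -mulrA c0 mulr0.
by left; exists 0; rewrite aE c0 mulr0 mul0r.
Qed.

Section CompletelyPrime.
Variable R : pzRingType.
Hypothesis noethl : noetherian_module R^o.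
Hypothesis noethr : noetherian_module (R^c)^o.
Hypothesis princR : left_ideals_principal R.
Implicit Types (x y z a b c : R).

Local Notation J := (jacobson_radical R).

(** In R / J, suppose that a is nonzero and ab = 0.  Put z = bc for any c.  The
    annihilators of the powers z^n are stationary at some n, hence R z^n meets
    the annihilator of z trivially; as that annihilator contains a, uniformity
    forces z^n = 0.  So bc, and therefore cb, is nilpotent for every c, and b is
    in the radical of R / J, which is 0. *)
Lemma uniform_jacobson_prime :
    (forall x y, x \notin J -> y \notin J ->
       exists a b, a * x \notin J /\ a * x - b * y \in J) ->
  forall a b, a * b \in J -> b \notin J -> a \in J.
Proof.
move=> unif a b Jab Jb; apply: contraNT Jb => Ja.
apply/(jacobsonP noethl) => c; pose z := b * c.
have [| |n stab] := @noetherian_chain R R^o noethl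
  (fun n (y : R) => y * z ^+ n \in J).
- move=> n; split=> [|r x y Jx Jy]; first by rewrite mul0r ideal0.
  rewrite mulrDl -[r *: x]/(r * x) -mulrA; apply: ideal_addr => //.
  exact: ideal_mull.
- by move=> n y Jy; rewrite exprSr mulrA; apply: jacobson_mulr.
have Jzn : z ^+ n \in J.
  apply: contrapT => /negP Jzn; have [s [t [/negP Js Jst]]] := unif _ _ Jzn Ja.
  apply/Js/stab; rewrite exprSr mulrA -(subrK (t * a) (s * _)) mulrDl.
  apply: ideal_addr; first exact: jacobson_mulr.
  rewrite -mulrA; apply: ideal_mull; rewrite mulrA; exact: jacobson_mulr.
apply: (@exp_linv _ _ n.+1); rewrite exp_mulS.
have /(jacobson_unit noethl)[s [s1 _]] : c * z ^+ n * b \in J.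
  by apply: jacobson_mulr => //; apply: ideal_mull.
by exists s.
Qed.

Hypothesis primeJ : forall a b, a * b \in J -> b \notin J -> a \in J.

(** Let Rw + J = Rw' with w = bw'.  Modulo the completely prime ideal J the
    element b is right invertible, hence invertible, and units lift modulo J; so
    Rw = Rw' contains J.  Complete primeness then gives J = Jw. *)
Lemma jacobson_right_mul w : 1 \notin J -> w \notin J ->
  forall x, x \in J -> exists2 y, y \in J & x = y * w.
Proof.
move=> J1 Jw x Jx; have [w' w'P] := princR (adjoin J (w : R^o)).
have [b wE] : exists r, w = r * w' by apply/w'P/mem_adjoin.
have [a w'E] : exists a, w' - a * w \in J.
  by apply/(@adjoinP R R^o)/w'P; exists 1; rewrite mul1r.
have Jba : 1 - b * a \in J.
  apply: (primeJ _ Jw); rewrite mulrBl mul1r {1}wE -mulrA -mulrBr.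
  exact: ideal_mull.
have [s] := jacobson_unit noethl Jba; rewrite subKr => -[_ bas].
have Jb : b \notin J.
  by apply: contra J1 => Jb; rewrite -bas -mulrA; apply: jacobson_mulr.
have Jasb : 1 - a * s * b \in J.
  apply: contraNT Jb => Jasb; apply: (primeJ _ Jasb).
  by rewrite mulrBr mulr1 !mulrA bas mul1r subrr ideal0.
have [t] := jacobson_unit noethl Jasb; rewrite subKr mulrA => -[cb1 _].
have [k xE] : exists r, x = r * w' by apply/w'P/sub_adjoin.
have xkw : x = k * (t * (a * s)) * w.
  by rewrite wE -mulrA [_ * (b * w')]mulrA cb1 mul1r.
by exists (k * (t * (a * s))) => //; apply: (primeJ _ Jw); rewrite -xkw.
Qed.

(** If J = Rp with p nonzero and z is not in J, then p = tpz for some t, and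
    [right_fixpoint] gives t^n p (1 - sz) = 0.  Since right multiplication by an
    element outside J is injective on J, 1 - sz is in J. *)
Lemma prime_jacobson_dichotomy : 1 \notin J -> zero_submod J \/ nonunit_ideal J.
Proof.
move=> J1; have [p pP] := princR J.
have Jp : p \in J by apply/pP; exists 1; rewrite mul1r.
have [p0|/eqP p0] := eqVneq p 0.
  by left=> x /pP[r ->]; rewrite p0 mulr0.
right; split=> // z Jz.
have [_ /pP[t ->]] := jacobson_right_mul J1 Jz Jp.
move=> /(right_fixpoint noethr)[n [s [pE tp0]]].
have Jsz : 1 - s * z \in J.
  apply: contrapT => /negP Jw; apply: p0; rewrite pE.
  have -> : t ^+ n * p = 0; last by rewrite mul0r.
  apply: (surj_right_mul_inj noethl (jacobson_right_mul J1 Jw)) tp0.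
  exact: ideal_mull.
have [u] := jacobson_unit noethl Jsz; rewrite subKr mulrA => -[usz _].
by exists (u * s).
Qed.

End CompletelyPrime.

(** * Local rings with principal left ideals *)

Lemma simple_quot_restr (R : pzRingType) (M : lmodType R)
    (A B : submodClosed M) b0 :
    b0 \in B -> b0 \notin A ->
    (forall b c, b \in B -> b \notin A -> c \in B ->
       exists a, c - a *: b \in A) ->
  simple_module (quotmod (restr A B)).
Proof.
move=> Bb0 Ab0 gen; split.
  by exists (quot_proj (restr A B) (Sub b0 Bb0)); rewrite quot_proj_neq0.
move=> S; have [|/nonzero_submodP[u Su]] := pselect (zero_submod S).
  by left.
rewrite -[u]quot_reprK quot_proj_neq0 => Au; right=> v.
have [a Ac] := gen _ (val (quot_repr v)) (valP (quot_repr u)) Au (valP _).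
have -> : v = a *: u; last by rewrite rpredZ.
rewrite -[v]quot_reprK -[u]quot_reprK -linearZ; apply/quot_projP.
by rewrite -linearZ -linearB /= in Ac.
Qed.

Section LocalPrincipal.
Variable R : pzRingType.
Implicit Types x y z a b p : R.

(** The composition series is given by the powers Rp^k, up to the first one that
    vanishes.  Consecutive powers differ since 1 - sp is left invertible, and
    the quotients are simple since multipliers outside I are left invertible. *)
Lemma nilpotent_finite_length p n (I : submodClosed R^o) :
    (forall x, x \in I <-> exists r, x = r * p) -> nonunit_ideal I ->
  p ^+ n = 0 -> left_finite_length R.
Proof.
move=> Ip [I1 invI] pn0.
have expE : exists n, p ^+ n == 0 by exists n; apply/eqP.
case: (ex_minnP expE) => {n pn0 expE} n /eqP pn0 minn.
(* The series must increase with i, hence the exponent n - i. *)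
exists n, (fun i => cyclic_submod (p ^+ (n - i) : R^o)); split.
- move=> x /cyclic_submodP[a ->]; rewrite subn0 pn0; exact: mulr0.
- move=> x; apply/(@cyclic_submodP R R^o); exists x; rewrite subnn expr0.
  exact: esym (mulr1 x).
move=> i ltin; have -> : (n - i)%N = (n - i.+1).+1 by rewrite subnSK.
set k := (n - i.+1)%N; have ltkn : (k < n)%N.
  by rewrite /k ltn_subrL /=; apply: leq_ltn_trans ltin.
split.
  move=> x /(@cyclic_submodP R R^o)[a ->]; apply/(@cyclic_submodP R R^o).
  by exists (a * p); rewrite exprS; apply: mulrA.
apply: (@simple_quot_restr R R^o _ _ (p ^+ k)).
- exact: mem_cyclic_submod.
- apply/negP => /(@cyclic_submodP R R^o)[s pkE].
  have /(ideal_subl1 I1)/invI[t t1] : s * p \in I by apply/Ip; exists s.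
  have : p ^+ k != 0 by apply: contraL ltkn => /minn; rewrite -leqNgt.
  case/eqP; rewrite -[_ ^+ _]mul1r -t1 -mulrA mulrBl mul1r -mulrA -exprS.
  by rewrite {1}pkE -[_ *: _]/(s * p ^+ k.+1) subrr mulr0.
move=> b c /(@cyclic_submodP R R^o)[r bE] Ab /(@cyclic_submodP R R^o)[d cE].
rewrite -[_ *: _]/(r * p ^+ k) in bE; rewrite -[_ *: _]/(d * p ^+ k) in cE.
have /invI[s s1] : r \notin I.
  apply: contra Ab => /Ip[t rE]; apply/(@cyclic_submodP R R^o); exists t.
  by rewrite bE rE -mulrA -exprS.
exists (d * s); rewrite -[_ *: _]/(d * s * b) bE cE.
by rewrite -[d * s * _]mulrA [s * (r * _)]mulrA s1 mul1r subrr ideal0.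
Qed.

Hypothesis noethl : noetherian_module R^o.
Hypothesis noethr : noetherian_module (R^c)^o.
Hypothesis princR : left_ideals_principal R.

Local Notation J := (jacobson_radical R).

(** The left annihilator of p contains no Rp^n, so by comparability it is
    contained in the intersection I of all of them.  Therefore I = Ip: if
    x = yp lies in I, then y differs from a multiple of p^n by an element that
    kills p.  Being principal, I is generated by some x = rxp, which vanishes by
    [right_fixpoint].  Hence p is cancellable on the right, and so is every
    nonzero element, as a unit times a power of p. *)
Lemma nonnilpotent_domain p : (forall x, x \in J <-> exists r, x = r * p) ->
  nonunit_ideal J -> (forall n, p ^+ n != 0) -> GRing.integral_domain_axiom R.
Proof.
move=> Jp invJ pn0; have [J1 linvJ] := invJ.
have uni := uniserial_comparable (local_uniserial princR invJ).
have annP y n : y * p = 0 -> exists r, y = r * p ^+ n.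
  move=> yp0; have [//|[r pE]] := uni y (p ^+ n).
  by have /eqP := pn0 n.+1; rewrite exprSr pE -mulrA yp0 mulr0.
have [|x xP] := @principal_prop R princR
  (fun x => forall n, exists r, x = r * p ^+ n).
  split=> [n|a y z Iy Iz n]; first by exists 0; rewrite mul0r.
  have [[r ->] [s ->]] := (Iy n, Iz n).
  by exists (a * r + s); rewrite -[_ *: _]/(a * _) mulrDl mulrA.
have Ix : forall n, exists r, x = r * p ^+ n.
  by apply/xP; exists 1; rewrite mul1r.
have [y xyp] := Ix 1%N; rewrite expr1 in xyp.
have [r yE] : exists r, y = r * x.
  apply/xP => n; have [s xE] := Ix n.+1.
  have [|t tE] := annP (y - s * p ^+ n) n.
    by rewrite mulrBl -mulrA -exprSr -xyp -xE subrr.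
  by exists (t + s); rewrite mulrDl -tE subrK.
have x0 : x = 0.
  have xE : x = r * x * p by rewrite -yE.
  have [n [s [{}xE]]] := right_fixpoint noethr xE.
  have /(jacobson_unit noethl)[u [_ u1]] : s * p \in J by apply/Jp; exists s.
  move=> /(congr1 (fun z => z * u)) /=; rewrite mul0r -mulrA u1 mulr1 => x0.
  by rewrite xE x0 mul0r.
have I0 y' : (forall n, exists r, y' = r * p ^+ n) -> y' = 0.
  by move/xP=> [s ->]; rewrite x0 mulr0.
have reg n z : z * p ^+ n = 0 -> z = 0.
  elim: n => [|n IH]; first by rewrite mulr1.
  by rewrite exprSr mulrA => /annP an; apply/IH/I0 => m; apply: an.
move=> b a ba0; have [//|/eqP a0] := eqVneq a 0; first by rewrite orbT.
rewrite orbF; have exn : exists n, `[< ~ exists r, a = r * p ^+ n >].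
  apply: contrapT => noN; apply/a0/I0 => n.
  by apply: contrapT => noR; apply: noN; exists n; apply/asboolP.
case: (ex_minnP exn) => -[|n] /asboolP nota minn.
  by case: nota; exists a; rewrite mulr1.
have [u aE] : exists r, a = r * p ^+ n.
  apply: contrapT => /asboolP/minn; by rewrite ltnn.
have Ju : u \notin J.
  by apply/negP => /Jp[k uE]; case: nota; exists k; rewrite aE uE exprS mulrA.
have [s s1] := linvJ _ Ju.
have Js : s \notin J.
  by apply: contra J1 => Js; rewrite -s1; apply: jacobson_mulr.
have [t t1] := linvJ _ Js.
have us1 : u * s = 1.
  have -> : u = t by rewrite -[u]mul1r -t1 -mulrA s1 mulr1.
  exact: t1.
by apply/eqP; rewrite -[b]mulr1 -us1 mulrA (reg n (b * u)) ?mul0r // -mulrA -aE.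
Qed.

Lemma local_principal_dichotomy : nonunit_ideal J ->
  left_finite_length R \/ principal_left_ideal_domain R.
Proof.
move=> invJ; have [p pP] := princR J.
have [[n pn0]|nonnil] := pselect (exists n, p ^+ n = 0).
  by left; apply: nilpotent_finite_length pP invJ pn0.
right; do 2!split=> //.
  have [J1 _] := invJ; apply: contraNneq J1 => ->; exact: ideal0.
apply: nonnilpotent_domain pP invJ _ => n; apply/eqP => pn0.
by apply: nonnil; exists n.
Qed.

End LocalPrincipal.

(** * Principal left ideal domains *)

(** If Rx and Ry met trivially, the sum of the Rxy^i would be direct, contrary
    to the chain condition. *)
Lemma noetherian_ore (R : pzRingType) (x y : R) :
    noetherian_module R^o -> GRing.integral_domain_axiom R ->
  x != 0 -> y != 0 -> exists a b, a * x = b * y /\ a * x != 0.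
Proof.
move=> noeth dom x0 y0; apply: contrapT => indep.
have noCM a b : a * x = b * y -> a * x = 0.
  by move=> ab; apply: contrapT => /eqP ax0; apply: indep; exists a, b.
(* P n is the left ideal generated by the x y^i with i < n. *)
pose P := fix P n z : Prop :=
  if n is m.+1 then exists a w, P m w /\ z = a * x + w * y else z = 0.
have PP n : submod_prop (P n : R^o -> Prop).
  elim: n => [|n [P0 PZ]].
    by split=> [|a z w] //= -> ->; rewrite scaler0 addr0.
  split=> [|c _ _ [a [w [Pw ->]]] [b [v [Pv ->]]]].
    by exists 0, 0; rewrite !mul0r addr0.
  exists (c * a + b), (c * w + v); split; first exact: PZ.
  by rewrite -[_ *: _]/(c * _) mulrDr !mulrDl !mulrA addrACA.
have incP n z : P n z -> P n.+1 z.
  elim: n z => [|n IH] z /=; first by exists 0, 0; rewrite !mul0r addr0.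
  by case=> a [w [/IH Pw zE]]; exists a, w.
have [n stab] := noetherian_chain noeth PP incP.
(* Cancelling y on the right moves a stationary step down the chain. *)
have stab0 : forall z, P 1%N z -> P 0%N z.
  elim: n stab => // n IH stab; apply: IH => z Pz.
  have [|a [w [Pw zyE]]] := stab (z * y).
    by exists 0, z; rewrite mul0r add0r.
  have /noCM ax0 : a * x = (z - w) * y by rewrite mulrBl zyE addrK.
  have /dom/orP[|] : (z - w) * y = 0 by rewrite mulrBl zyE addrK.
    by rewrite subr_eq0 => /eqP ->.
  by rewrite (negPf y0).
by move/eqP: x0; apply; apply: stab0; exists 1, 0; rewrite mul1r mul0r addr0.
Qed.

Section PrincipalLeftIdealDomain.
Variable R : pzRingType.
Hypothesis domR : GRing.integral_domain_axiom R.
Hypothesis princR : left_ideals_principal R.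
Implicit Types a b c d e f u v k : R.

Lemma domain_mulIr c a b : c != 0 -> a * c = b * c -> a = b.
Proof.
move=> c0 /eqP; rewrite -subr_eq0 -mulrBl => /eqP/domR.
by rewrite (negPf c0) orbF subr_eq0 => /eqP.
Qed.

(** After cancelling a common right factor, (c', d') is unimodular:
    uc' + vd' = 1.  The map (x, y) |-> xc' - yd' from R^2 onto R splits, and its
    kernel is free on one generator (e, f); so (e, f) is part of a basis of R^2,
    that is, eR + fR = R.  Since (a, b) is in the kernel it equals k (e, f), and
    aR + bR = kR. *)
Lemma right_bezout a b c d : a != 0 -> d != 0 -> a * c = b * d ->
  exists k e f x y, [/\ a = k * e, b = k * f & k = a * x + b * y].
Proof.
move=> a0 d0 ac_bd.
have [c' [d' [g [u [v [cE dE gE]]]]]] := principal_pair princR c d.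
have g0 : g != 0 by apply: contraNneq d0 => g0; rewrite dE g0 mulr0.
have d'0 : d' != 0 by apply: contraNneq d0 => d'0; rewrite dE d'0 mul0r.
have uv1 : u * c' + v * d' = 1.
  by apply: (domain_mulIr g0); rewrite mulrDl -!mulrA -cE -dE -gE mul1r.
have ac'_bd' : a * c' = b * d'.
  by apply: (domain_mulIr g0); rewrite -!mulrA -cE -dE.
have [|e eP] := @principal_prop R princR (fun x => exists y, x * c' = y * d').
  split=> [|r x z [y xE] [w zE]]; first by exists 0; rewrite !mul0r.
  by exists (r * y + w); rewrite -[_ *: _]/(r * _) !mulrDl -!mulrA xE zE.
have [f ecE] : exists y, e * c' = y * d' by apply/eP; exists 1; rewrite mul1r.
have ker x y : x * c' = y * d' -> exists r, x = r * e /\ y = r * f.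
  move=> xy; have [|r xE] := (eP x).1; first by exists y.
  exists r; split=> //; apply: (domain_mulIr d'0).
  by rewrite -xy xE -!mulrA ecE.
have [k [aE bE]] := ker _ _ ac'_bd'.
(* (u, -v) is sent to 1, so (1, 0) - c'(u, -v) and (0, -1) - d'(u, -v) lie in
   the kernel; their coordinates al and be are what combines e and f to 1. *)
have [al [alE alF]] : exists r, 1 - c' * u = r * e /\ c' * v = r * f.
  apply: ker; rewrite mulrBl mul1r -!mulrA.
  by rewrite -{1}[c']mulr1 -mulrBr -uv1 addrC addKr.
have [be [beE beF]] : exists r, - (d' * u) = r * e /\ d' * v - 1 = r * f.
  apply: ker; rewrite mulrBl mul1r mulNr -!mulrA -{4}[d']mulr1 -mulrBr -uv1.
  by rewrite opprD addrCA subrr addr0 mulrN.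
have e0 : e != 0 by apply: contraNneq a0 => e0; rewrite aE e0 mulr0.
have ef1 : e * al - f * be = 1.
  apply: (domain_mulIr e0).
  rewrite mul1r mulrBl -!mulrA -alE -beE mulrN opprK mulrBr mulr1 !mulrA.
  by rewrite ecE subrK.
exists k, e, f, al, (- be); split=> //.
by rewrite aE bE -!mulrA -mulrDr mulrN ef1 mulr1.
Qed.

End PrincipalLeftIdealDomain.

(** A maximal principal right ideal aR inside I is all of I: for x in I, the Ore
    condition makes [right_bezout] applicable to a and x, so aR + xR is
    principal. *)
Lemma pli_domain_principal_right (R : pzRingType) :
    noetherian_module (R^c)^o -> principal_left_ideal_domain R ->
  right_ideals_principal R.
Proof.
move=> noeth [[_ dom] princR] I.
have domc : GRing.integral_domain_axiom R^c.
  by move=> x y xy0; rewrite orbC; apply: dom.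
pose P (N : submodClosed (R^c)^o) :=
  exists2 a : R, a \in I & forall x : R, x \in N <-> exists r, x = a * r.
have cycP (a : R) : a \in I -> P (cyclic_submod (a : (R^c)^o)).
  by exists a => // x; apply: (@cyclic_submodP R^c (R^c)^o).
have [|N [[a Ia aN] _ maxN]] := noetherian_maximal noeth (cycP 0 _).
  exact: rpred0.
exists a => x; split=> [Ix|[r ->]]; last exact: (@rpredZ _ (R^c)^o).
apply/aN.
have [xa|xa] := pselect (exists r, x = a * r); first exact/aN.
have a0 : a != 0.
  apply/negP => /eqP a0; suff : x \in N by case/aN => r xE; apply: xa; exists r.
  apply: (maxN _ (cycP x Ix)); last exact: mem_cyclic_submod.
  by move=> _ /aN[r ->]; rewrite a0 mul0r; apply: rpred0.
have x0 : x != 0.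
  by apply/negP => /eqP x0; apply: xa; exists 0; rewrite mulr0.
have [c [d [acE ac0]]] := @noetherian_ore R^c a x noeth domc a0 x0.
have d0 : d != 0.
  by apply: contraNneq ac0 => d0; rewrite acE d0 mul0r.
have [k [e [f [s [t [aE xE kE]]]]]] := right_bezout dom princR a0 d0 acE.
have Ik : k \in I.
  by rewrite kE; apply: (@rpredD (R^c)^o); apply: (@rpredZ _ (R^c)^o).
apply: (maxN _ (cycP k Ik)).
  move=> _ /aN[r ->]; apply/(@cyclic_submodP R^c (R^c)^o).
  by exists (e * r); rewrite aE -mulrA.
by apply/(@cyclic_submodP R^c (R^c)^o); exists f.
Qed.

(** * Cyclic-uniform uniserial rings *)

Section CuUniserialRing.
Variable R : pzRingType.

Lemma zero_ring_trivial : (1 : R) = 0 -> forall x : R, x = 0.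
Proof. by move=> one0 x; rewrite -[x]mulr1 one0 mulr0. Qed.

Lemma zero_ring_uniserial : (1 : R) = 0 -> left_uniserial_ring R.
Proof.
move=> /zero_ring_trivial R0 N L; left=> x _.
by rewrite (R0 x); apply: rpred0.
Qed.

Lemma zero_ring_finite_length : (1 : R) = 0 -> left_finite_length R.
Proof.
move=> /zero_ring_trivial R0; exists 0%N, (fun=> jacobson_radical R).
by split=> // x; rewrite (R0 x); apply: rpred0.
Qed.

Lemma cu_uniserial_principal : noetherian_module R^o ->
  left_cu_uniserial_ring R -> left_ideals_principal R.
Proof.
move=> noeth cu I; have [I0|nzI] := pselect (zero_submod I).
  exists 0 => x; split=> [/I0 ->|[r ->]]; first by exists 0; rewrite mulr0.
  by rewrite mulr0; apply: rpred0.
have noethI := @noetherian_submod _ _ noeth I.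
have [cyc _] := cu I (noetherian_fg noethI) nzI.
have [g gP] := noetherian_cyclic noethI cyc.
exists (val g) => x; split=> [Ix|[r ->]]; last exact: ideal_mull (valP g).
have [r /(congr1 val)] := gP (@Submod R R^o I x Ix).
by rewrite linearZ /=; exists r.
Qed.

(** The hypothesis is applied to the unit ideal, seen as a submodule T of R. *)
Lemma cu_uniserial_uniform : noetherian_module R^o -> (1 : R) != 0 ->
    left_cu_uniserial_ring R ->
  uniform_module (quotmod (jacobson_radical R)).
Proof.
move=> noeth one0 cu.
have topP : submod_prop (fun _ : R^o => True) by [].
pose T := mk_submod topP.
have inT (x : R^o) : x \in T by apply/mk_submodP.
have fgT := noetherian_fg (@noetherian_submod _ _ noeth T).
have [|_ /uniform_quotP[nfull unif]] := cu T fgT.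
  by move/(_ 1 (inT 1))/eqP; apply/negP.
have radE (k : submod T) :
    (k \in Rad (submod T)) = (val k \in jacobson_radical R).
  apply: (@Rad_iso R (submod T) R^o (\val : {linear submod T -> R^o})).
    exact: val_inj.
  by move=> y; exists (@Submod R R^o T y (inT y)).
apply/uniform_quotP; split=> [full|x y Jx Jy].
  by apply: nfull => k; rewrite radE.
have [||a [b]] := unif (@Submod R R^o T x (inT x)) (@Submod R R^o T y (inT y)).
- by rewrite radE.
- by rewrite radE.
by rewrite !radE; exists a, b.
Qed.

Lemma cu_uniserial_classification :
    noetherian_ring R -> left_cu_uniserial_ring R ->
  (left_uniserial_ring R /\ left_finite_length R)
  \/ (principal_left_ideal_domain R /\ zero_submod (jacobson_radical R))
  \/ (local_ring R /\ principal_left_ideal_domain R).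
Proof.
move=> [noethl noethr] cu.
have [one0|one0] := eqVneq (1 : R) 0.
  by left; split; [apply: zero_ring_uniserial | apply: zero_ring_finite_length].
have princR := cu_uniserial_principal noethl cu.
have /uniform_quotP[nfull unif] := cu_uniserial_uniform noethl one0 cu.
have J1 : 1 \notin jacobson_radical R by apply/negP => /ideal_full.
have primeJ := uniform_jacobson_prime noethl unif.
have [J0|invJ] := prime_jacobson_dichotomy noethl noethr princR primeJ J1.
  right; left; split=> //; do 2!split=> //.
  move=> a b ab0; have [//|/eqP b0] := eqVneq b 0; first by rewrite orbT.
  rewrite orbF; apply/eqP/J0/(primeJ _ b); first by rewrite ab0; apply: ideal0.
  by apply/negP => /J0.
have locR : local_ring R.
  by apply/(local_ringP noethl); exists (jacobson_radical R).
have [fl|pli] := local_principal_dichotomy noethl noethr princR invJ.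
  by left; split=> //; apply: local_uniserial princR invJ.
by right; right.
Qed.

Lemma uniserial_cu_uniserial :
  noetherian_module R^o -> left_uniserial_ring R -> left_cu_uniserial_ring R.
Proof.
move=> noeth /uniserial_comparable comp K _ /nonzero_submodP[x0 Kx0 x00].
have noethK := @noetherian_submod _ _ noeth K.
have compK (k l : submod K) : (exists a, k = a *: l) \/ (exists a, l = a *: k).
  have [[a kl]|[a lk]] := comp (val k) (val l); [left|right];
    by exists a; apply: val_inj; rewrite linearZ.
have nfull : ~ full_submod (Rad (submod K)).
  have zeroP : submod_prop (fun k : submod K => k = 0).
    by split=> [|a x y -> ->]; rewrite ?scaler0 ?addr0.
  have [|N maxN _] := noetherian_sub_maximal noethK (N := mk_submod zeroP).
    move/(_ (@Submod R R^o K x0 Kx0))/mk_submodP/(congr1 val) => /= x0E.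
    by rewrite x0E eqxx in x00.
  case: (maxN) => nfullN _ full; apply: nfullN => k.
  exact: (RadP k).1 (full k) N maxN.
split; last first.
  apply/uniform_quotP; split=> // k l Jk Jl.
  have [[a kE]|[a lE]] := compK k l.
    by exists 1, a; rewrite scale1r; split=> //; rewrite kE subrr rpred0.
  by exists a, 1; rewrite -lE scale1r; split=> //; rewrite subrr rpred0.
pose P (N : submodClosed (submod K)) := exists k, N = cyclic_submod k.
have [|_ [[k ->] _ maxk]] := @noetherian_maximal _ _ noethK P (cyclic_submod 0).
  by exists 0.
exists (quot_proj _ k) => u.
have [[a lE]|[a kE]] := compK (quot_repr u) k.
  by exists a; rewrite -linearZ /= -lE quot_reprK.
have /cyclic_submodP[b uE] : quot_repr u \in cyclic_submod k.
  apply: (maxk (cyclic_submod (quot_repr u))).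
  - by exists (quot_repr u).
  - move=> _ /cyclic_submodP[c ->]; rewrite kE scalerA.
    by apply/cyclic_submodP; exists (c * a).
  exact: mem_cyclic_submod.
by exists b; rewrite -linearZ /= -uE quot_reprK.
Qed.

Lemma semiprimitive_pli_domain_cu_uniserial :
    noetherian_module R^o -> principal_left_ideal_domain R ->
    zero_submod (jacobson_radical R) ->
  left_cu_uniserial_ring R.
Proof.
move=> noeth [[one0 dom] princR] J0 K _ nzK.
have [g gP] := princR K.
have gK (r : R) : r * g \in K by apply/gP; exists r.
have g0 : g != 0.
  by apply/eqP => g0; apply: nzK => x /gP[r ->]; rewrite g0 mulr0.
pose f (r : R^o) : submod K := @Submod R R^o K (r * g) (gK r).
have f_lin : linear f.
  move=> a x y; apply: val_inj; rewrite linearP /= mulrDl; congr (_ + _).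
  exact: esym (mulrA a x g).
pose fL : {linear R^o -> submod K} :=
  HB.pack f (GRing.isLinear.Build R R^o (submod K) *:%R f f_lin).
have f_inj : injective fL.
  by move=> x y /(congr1 val) /=; apply: domain_mulIr.
have f_surj k : exists r, k = fL r.
  by have /gP[r kE] := valP k; exists r; apply: val_inj.
have radE r : (fL r \in Rad (submod K)) = (r == 0).
  rewrite -(Rad_iso _ f_inj f_surj); apply/idP/eqP => [/J0 //|->].
  exact: ideal0.
split.
  exists (quot_proj _ (fL 1)) => u; have [r uE] := f_surj (quot_repr u).
  exists r; rewrite -[LHS]quot_reprK uE -linearZ /= ; congr quot_proj.
  by apply: val_inj; rewrite linearZ /= mul1r.
apply/uniform_quotP; split=> [/(_ (fL 1))|k l].
  by rewrite radE (negPf one0).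
have [[x ->] [y ->]] := (f_surj k, f_surj l); rewrite !radE => x0 y0.
have [a [b [ab ax0]]] := noetherian_ore noeth dom x0 y0.
exists a, b; rewrite -!linearZ -linearB !radE subr_eq0; split=> //.
exact/eqP.
Qed.

End CuUniserialRing.

Theorem theorem2p9 (R : pzRingType) (noethR : noetherian_ring R) :
  [<-> (* (a) *) left_cu_uniserial_ring R;
       (* (b) *) (left_uniserial_ring R /\ left_finite_length R)
              \/ (principal_left_ideal_domain R
                  /\ zero_submod (jacobson_radical R))
              \/ (local_ring R /\ principal_left_ideal_domain R);
       (* (c) *) left_uniserial_ring R
              \/ (principal_left_ideal_domain R
                  /\ zero_submod (jacobson_radical R));
       (* (d) *) left_uniserial_ring R
              \/ (principal_ideal_domain R
                  /\ zero_submod (jacobson_radical R))].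
Proof.
have [noethl noethr] := noethR; tfae.
- exact: cu_uniserial_classification.
- case=> [[uni _]|[pli|[/(local_ringP noethl)[I invI] [_ princR]]]].
  + by left.
  + by right.
  + by left; apply: local_uniserial princR invI.
- case=> [uni|[pli J0]]; [by left | right; split=> //].
  have right_princ := pli_domain_principal_right noethr pli.
  by case: pli.
- case=> [uni|[[dom princl _] J0]]; first exact: uniserial_cu_uniserial.
  exact: semiprimitive_pli_domain_cu_uniserial.
Qed.
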